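(* Let $n,d\ge 1$ be integers and let $C$ be any convex position in $[n]^d$. Then the same maximal position is ultimately reached from $C$ by any sequence of moves, regardless of whether they are dictated by the build-up process, by bootstrap percolation, or by modified bootstrap percolation. That is, there is a single position $D$, maximal for the build-up process, such that every build-up from $C$ that is continued until a maximal position is reached ends in $D$, and $D$ is also the final set of active sites of both bootstrap percolation and modified bootstrap percolation when the initial set of active sites is $C$.
   Context: $[n]^d$ denotes the graph whose vertices (also called cubes or sites) are the $d$-tuples $(x_1,\dots,x_d)$ with $x_i\in\{1,\dots,n\}$; two vertices are neighbours if they differ in exactly one coordinate, and in that coordinate by exactly $1$. A line is a set of $n$ vertices obtained by fixing $d-1$ coordinates and letting the remaining one vary. A position is any subset of the vertices of $[n]^d$; its vertices are called black (or active) and the remaining vertices are called white (or inactive). A position is convex if no line contains one or more white vertices between two black vertices. A build-up is a sequence of moves, each of which adds to the current position one white vertex having exactly $d$ black neighbours in the current position. A position is maximal if no white vertex has exactly $d$ black neighbours. In bootstrap percolation, at each step all inactive sites having at least $d$ active neighbours simultaneously become active; in modified bootstrap percolation, at each step all inactive sites having at least one active neighbour in each of the $d$ coordinate directions (i.e. at least one active neighbour on each of the $d$ lines through the site) simultaneously become active. Active sites remain active forever. *)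

(* Defs.v *)
From mathcomp Require Import all_boot.

Set Implicit Arguments.
Unset Strict Implicit.
Unset Printing Implicit Defensive.

(* Coordinates are numbered 0, ..., n - 1 instead of 1, ..., n. *)
Notation vertex n d := {ffun 'I_d -> 'I_n}.

Section Grid.
Variables n d : nat.
Implicit Types (x y v : vertex n d) (i j : 'I_d) (A B C D : {set vertex n d}).

Definition adjacent x y : bool :=
  [exists i, (((x i).+1 == y i :> nat) || ((y i).+1 == x i :> nat))
             && [forall (j | j != i), x j == y j]].

(* The line through x along which coordinate i varies. *)
Definition line i x : {set vertex n d} :=
  [set y : vertex n d | [forall (j | j != i), y j == x j]].

Definition black_neighbours A v : {set vertex n d} :=
  [set y : vertex n d in A | adjacent v y].

Definition convex_position A : Prop :=
  forall i x a b c,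
    a \in line i x -> b \in line i x -> c \in line i x ->
    a \in A -> c \in A -> a i < b i -> b i < c i -> b \in A.

Definition build_up_move A B : bool :=
  [exists v, [&& v \notin A, #|black_neighbours A v| == d & B == v |: A]].

(* s lists the positions reached after each successive move, starting from A;
   the position at the end of the build-up is last A s. *)
Definition build_up A (s : seq {set vertex n d}) : bool :=
  path build_up_move A s.

Definition maximal_position A : Prop :=
  forall v, v \notin A -> #|black_neighbours A v| <> d.

Definition bootstrap_step A : {set vertex n d} :=
  A :|: [set v : vertex n d | (v \notin A) && (d <= #|black_neighbours A v|)].

Definition modified_bootstrap_step A : {set vertex n d} :=
  A :|: [set v : vertex n d | (v \notin A) &&
           [forall i, [exists y in black_neighbours A v, y \in line i v]]].

Definition final_active_set (step : {set vertex n d} -> {set vertex n d}) C D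
    : Prop :=
  exists K : nat, forall k : nat, K <= k -> iter k step C = D.

End Grid.

(* Main.v *)
Require Import Defs.
From mathcomp Require Import all_boot.
From mathcomp Require Import zify.

Set Implicit Arguments.
Unset Strict Implicit.
Unset Printing Implicit Defensive.

(** Convexity forces a white vertex to have at most one black neighbour on each
    line through it, hence at most [d] black neighbours, with equality exactly
    when every direction contributes one; so the three rules activate the same
    white vertices of a convex position.  A build-up move preserves convexity,
    since the added vertex prolongs by one step the black interval on each line
    through it.  Black neighbours are never lost, so every process started from
    [C] stays inside every convex maximal position containing [C], and all of
    them end in the same position. *)

(** * Lines, directions and convexity in the grid *)

Section Neighbours.
Variables n d : nat.
Implicit Types (x y z v : vertex n d) (i j : 'I_d) (A B C D E : {set vertex n d}).

Lemma lineP i x y : reflect (forall j, j != i -> y j = x j) (y \in line i x).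
Proof.
rewrite inE; apply: (iffP forallP) => [h j ji|h j].
  by move: (h j); rewrite ji => /eqP.
by apply/implyP => /h ->.
Qed.

Lemma line_inj i x y z :
  y \in line i x -> z \in line i x -> y i = z i :> nat -> y = z.
Proof.
move=> /lineP hy /lineP hz yz; apply/ffunP => j.
case: (eqVneq j i) => [->|ji]; first exact: val_inj.
by rewrite hy // hz.
Qed.

Lemma line_trans i x y z : y \in line i x -> z \in line i y -> z \in line i x.
Proof. by move=> /lineP hy /lineP hz; apply/lineP => j ji; rewrite hz // hy. Qed.

Lemma line_sym i x y : y \in line i x -> x \in line i y.
Proof. by move=> /lineP h; apply/lineP => j /h. Qed.

Lemma line_refl i x : x \in line i x.
Proof. exact/lineP. Qed.

Lemma adjacentP v y :
  reflect (exists2 i, y \in line i v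
                    & (v i).+1 = y i :> nat \/ (y i).+1 = v i :> nat)
          (adjacent v y).
Proof.
apply: (iffP existsP) => [[i /andP[hi /forallP h]]|[i /lineP h hi]].
  exists i; last by case/orP: hi => /eqP; [left | right].
  by apply/lineP => j ji; move: (h j); rewrite ji => /eqP.
exists i; apply/andP; split; first by case: hi => ->; rewrite eqxx ?orbT.
by apply/forallP => j; apply/implyP => /h ->.
Qed.

Lemma adjacent_line v y i :
  adjacent v y -> y \in line i v ->
  (v i).+1 = y i :> nat \/ (y i).+1 = v i :> nat.
Proof.
case/adjacentP => j _ hj /lineP hi.
by case: (eqVneq j i) hj => [->|/hi ->] //; lia.
Qed.

(** Adjacency along [i] changes coordinate [i] by one, whereas a line along any other [j] keeps that
    coordinate fixed. *)
Lemma adjacent_lines_eq v y i j :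
  adjacent v y -> y \in line i v -> y \in line j v -> i = j.
Proof.
move=> vy yi /lineP yj; apply/eqP; apply: contraT => /yj e.
by have := adjacent_line vy yi; rewrite e; lia.
Qed.

(** The base point of the line is eliminated: [a] itself can represent it. *)
Lemma convex_positionP A :
  convex_position A <->
  (forall i (a b c : vertex n d), b \in line i a -> c \in line i a -> a \in A -> c \in A ->
     a i < b i < c i -> b \in A).
Proof.
split=> h i a b c.
  by move=> ba ca aA cA /andP[]; apply: (h i a) => //; apply: line_refl.
move=> e ax bx cx aA eA ab bc.
have on_line z : z \in line i a -> z \in line i b.
  exact: line_trans (line_sym ax).
by apply: (h i b c e) => //; [exact: on_line | exact: on_line | rewrite ab].
Qed.

(** Spelled exactly as the activation test inside [modified_bootstrap_step], so that the two are
    convertible. *)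
Definition has_neighbour_in_each_direction A v : bool :=
  [forall i, [exists y in black_neighbours A v, y \in line i v]].

Lemma each_directionP A v :
  reflect (forall i, exists y, [/\ y \in A, adjacent v y & y \in line i v])
          (has_neighbour_in_each_direction A v).
Proof.
apply: (iffP forallP) => h i.
  have /existsP[y /andP[]] := h i.
  by rewrite inE => /andP[yA vy] yi; exists y.
by have [y [yA vy yi]] := h i; apply/existsP; exists y; rewrite inE yA vy.
Qed.

Lemma black_neighboursS A B v :
  A \subset B -> black_neighbours A v \subset black_neighbours B v.
Proof.
move=> sAB; apply/subsetP => y; rewrite !inE => /andP[yA ->].
by rewrite (subsetP sAB).
Qed.

Lemma each_directionS A B v : A \subset B ->
  has_neighbour_in_each_direction A v -> has_neighbour_in_each_direction B v.
Proof.
move=> sAB /each_directionP h; apply/each_directionP => i.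
by have [y [/(subsetP sAB) yB vy yi]] := h i; exists y.
Qed.

(** Meant for [y] adjacent to [v], where the line picked is unique and the value is never [None].
    Counting black neighbours becomes counting values of this map. *)
Definition direction v y : option 'I_d := [pick i | y \in line i v].

Lemma directionP v y : adjacent v y ->
  exists2 i, direction v y = Some i & y \in line i v.
Proof.
case/adjacentP => i yi _; rewrite /direction.
by case: pickP => [j yj|/(_ i)]; [exists j | rewrite yi].
Qed.

Lemma direction_line v y i :
  adjacent v y -> y \in line i v -> direction v y = Some i.
Proof.
move=> vy yi; have [j -> yj] := directionP vy.
by rewrite (adjacent_lines_eq vy yi yj).
Qed.

Lemma card_directions : #|[set Some i | i : 'I_d]| = d.
Proof. by rewrite card_imset ?card_ord //; apply: Some_inj. Qed.

Lemma direction_sub A v :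
  direction v @: black_neighbours A v \subset [set Some i | i : 'I_d].
Proof.
apply/subsetP => _ /imsetP[y + ->]; rewrite inE => /andP[_ /directionP[i -> _]].
exact: imset_f.
Qed.

Lemma each_direction_card A v :
  has_neighbour_in_each_direction A v -> d <= #|black_neighbours A v|.
Proof.
move=> /each_directionP h; rewrite -{1}card_directions.
apply: leq_trans (leq_imset_card (direction v) _).
apply/subset_leq_card/subsetP => _ /imsetP[i _ ->].
have [y [yA vy yi]] := h i; apply/imsetP; exists y; first by rewrite inE yA.
by rewrite (direction_line vy yi).
Qed.

(** Two distinct neighbours on one line lie on opposite sides of [v], so convexity would make [v]
    black. *)
Lemma convex_neighbour_unique A v i y z : convex_position A -> v \notin A ->
  y \in A -> adjacent v y -> y \in line i v ->
  z \in A -> adjacent v z -> z \in line i v -> y = z.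
Proof.
move=> /convex_positionP cA vA yA vy yi zA vz zi.
have hy := adjacent_line vy yi; have hz := adjacent_line vz zi.
have vyi := line_sym yi; have vzi := line_sym zi.
case: (ltngtP (y i) (z i)) => [lt|gt|]; last exact: line_inj yi zi.
- by case/negP: vA; apply: (cA i y v z) => //; [exact: line_trans zi | lia].
- by case/negP: vA; apply: (cA i z v y) => //; [exact: line_trans yi | lia].
Qed.

Lemma direction_inj A v : convex_position A -> v \notin A ->
  {in black_neighbours A v &, injective (direction v)}.
Proof.
move=> cA vA y z; rewrite !inE => /andP[yA vy] /andP[zA vz].
have [i -> yi] := directionP vy; have [j -> zj] := directionP vz.
case=> eij; rewrite -{j}eij in zj.
exact: (convex_neighbour_unique cA vA yA vy yi zA vz zj).
Qed.

Lemma convex_card_neighbours A v : convex_position A -> v \notin A ->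
  #|black_neighbours A v| <= d.
Proof.
move=> cA vA; rewrite -(card_in_imset (direction_inj cA vA)).
by rewrite -[leqRHS]card_directions subset_leq_card // direction_sub.
Qed.

(** An injection of at least [d] black neighbours into the [d] directions is onto. *)
Lemma convex_each_direction A v : convex_position A -> v \notin A ->
  d <= #|black_neighbours A v| -> has_neighbour_in_each_direction A v.
Proof.
move=> cA vA hd; have full : direction v @: black_neighbours A v
    = [set Some i | i : 'I_d].
  apply/eqP; rewrite eqEcard direction_sub card_directions.
  by rewrite (card_in_imset (direction_inj cA vA)).
apply/each_directionP => i.
have : Some i \in direction v @: black_neighbours A v.
  by rewrite full imset_f.
case/imsetP => y; rewrite inE => /andP[yA vy].
by have [j -> yj] := directionP vy => -[->]; exists y.
Qed.

Lemma convex_add A v : convex_position A -> v \notin A ->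
  has_neighbour_in_each_direction A v -> convex_position (v |: A).
Proof.
move=> /convex_positionP cA vA /each_directionP h.
apply/convex_positionP => i a b c ba ca.
have [y [yA vy yi]] := h i; have hy := adjacent_line vy yi.
rewrite !inE => /orP[/eqP ea|aA] /orP[/eqP ec|cA'] abc; apply/orP.
- by subst a c; lia.
(* With [v] as lower end, a neighbour [y] below [v] would enclose [v] together with [c]. So [y] is
   just above [v], and [b] is either [y] or strictly between [y] and [c]. The case of [v] as upper
   end is symmetric. *)
- subst a; right; case: hy => hy; last first.
    by case/negP: vA; apply: (cA i y v c) => //;
      [exact: line_sym | exact: line_trans (line_sym yi) ca | lia].
  case: (eqVneq (y i : nat) (b i)) => [e|ne].
    by rewrite -(line_inj yi ba e).
  by apply: (cA i y b c) => //; [exact: line_trans (line_sym yi) _.. | lia].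
- subst c; right; have ya := line_trans ca yi; case: hy => hy.
    by case/negP: vA; apply: (cA i a v y) => //; lia.
  case: (eqVneq (y i : nat) (b i)) => [e|ne].
    by rewrite -(line_inj ya ba e).
  by apply: (cA i a b y) => //; lia.
- by right; apply: (cA i a b c).
Qed.

End Neighbours.

(** * Build-ups and percolation as increasing processes *)

Section Processes.
Variables n d : nat.
Implicit Types (v : vertex n d) (A B C D E : {set vertex n d}).
Implicit Types s : seq {set vertex n d}.

Lemma build_up_moveP A B :
  reflect (exists v, [/\ v \notin A, #|black_neighbours A v| = d & B = v |: A])
          (build_up_move A B).
Proof.
apply: (iffP existsP) => -[v].
  by case/and3P => vA /eqP e /eqP ->; exists v.
by case=> vA e ->; exists v; rewrite vA e !eqxx.
Qed.

Lemma build_up_move_convex A B :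
  convex_position A -> build_up_move A B -> convex_position B.
Proof.
move=> cA /build_up_moveP[v [vA e ->]]; apply: convex_add => //.
by apply: convex_each_direction; rewrite ?e.
Qed.

Lemma build_up_convex A s :
  convex_position A -> build_up A s -> convex_position (last A s).
Proof.
elim: s A => //= B s IH A cA /andP[/(build_up_move_convex cA) cB].
exact: IH.
Qed.

Lemma build_up_sub A s : build_up A s -> A \subset last A s.
Proof.
elim: s A => //= B s IH A /andP[/build_up_moveP[v [_ _ ->]] /IH].
exact/subset_trans/subsetUr.
Qed.

Lemma build_up_to_maximal A :
  exists2 s, build_up A s & maximal_position (last A s).
Proof.
(* Induction on the number of white vertices, which every move decreases. *)
have [m] := ubnP #|~: A|; elim: m A => // m IH A lt_m.
case: (boolP [exists v, (v \notin A) && (#|black_neighbours A v| == d)]).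
  case/existsP => v /andP[vA /eqP e].
  have lt_v : #|~: (v |: A)| < m.
    rewrite ltnS in lt_m; apply: leq_trans lt_m; apply: proper_card.
    by rewrite properC setUC properUl // sub1set.
  have [s bs ms] := IH _ lt_v; exists (v |: A :: s) => //=.
  by apply/andP; split=> //; apply/build_up_moveP; exists v.
rewrite negb_exists => /forallP h; exists [::] => //= v vA.
by apply/eqP; move: (h v); rewrite vA.
Qed.

(** By convexity a white vertex with at least [d] black neighbours has exactly [d], which maximality
    excludes. *)
Lemma convex_maximal_closed D v : convex_position D -> maximal_position D ->
  d <= #|black_neighbours D v| -> v \in D.
Proof.
move=> cD mD le_d; apply: contraT => vD; case: (mD v vD).
by apply/eqP; rewrite eqn_leq le_d convex_card_neighbours.
Qed.

(** Comparison principle: each added vertex has a black neighbour in every direction, and it keeps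
    them in the larger set [E]. Here [E] will be another maximal end position or a fixed point of a
    percolation step. *)
Lemma build_up_in_closed A s E : convex_position A -> build_up A s ->
  A \subset E ->
  (forall v, has_neighbour_in_each_direction E v -> v \in E) ->
  last A s \subset E.
Proof.
move=> + + + cl; elim: s A => //= B s IH A cA /andP[mAB bs] sAE.
apply: IH bs _; first exact: build_up_move_convex mAB.
case/build_up_moveP: mAB => v [vA e ->]; rewrite subUset sub1set sAE andbT.
by apply/cl/(each_directionS sAE)/convex_each_direction; rewrite ?e.
Qed.

(** Common to both percolation rules: the iterates grow inside [D] and, by finiteness, reach a fixed
    point; it contains [C], hence [D]. *)
Lemma final_active_set_extensive (f : {set vertex n d} -> {set vertex n d}) C D :
    (forall A, A \subset f A) -> (forall A, A \subset D -> f A \subset D) ->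
    (forall E, f E = E -> C \subset E -> D \subset E) -> C \subset D ->
  final_active_set f C D.
Proof.
move=> ext fD DE CD.
have iter_sub k : C \subset iter k f C.
  by elim: k => //= k IH; apply: subset_trans IH (ext _).
have sub_iter k : iter k f C \subset D by elim: k => //= k; apply: fD.
have [K fixK] : exists K, f (iter K f C) = iter K f C.
  (* Until a fixed point occurs, each step gains a vertex; taking [k] one above the number of
     vertices rules out the second alternative. *)
  suff grow k : (exists K, f (iter K f C) = iter K f C) \/ k <= #|iter k f C|.
    by case: (grow #|{: vertex n d}|.+1) => //; rewrite ltnNge max_card.
  elim: k => [|k [|le_k]]; [by right | by left |].
  case: (eqVneq (f (iter k f C)) (iter k f C)) => [e|ne]; first by left; exists k.
  right; apply: leq_ltn_trans le_k _; apply: proper_card.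
  by rewrite properEneq eq_sym ne /=.
have eK : iter K f C = D.
  by apply/eqP; rewrite eqEsubset sub_iter; apply: DE.
exists K => k /subnK <-; rewrite iterD eK.
by elim: (k - K) => //= m ->; rewrite -eK.
Qed.

End Processes.

Theorem proposition3 (n d : nat) (hn : 1 <= n) (hd : 1 <= d)
    (C : {set vertex n d}) (hC : convex_position C) :
  exists D : {set vertex n d},
    [/\ maximal_position D,
        (forall s : seq {set vertex n d},
           build_up C s -> maximal_position (last C s) -> last C s = D),
        (forall s : seq {set vertex n d}, build_up C s ->
           exists t : seq {set vertex n d},
             build_up C (s ++ t) /\ last C (s ++ t) = D),
        final_active_set (@bootstrap_step n d) C D
      & final_active_set (@modified_bootstrap_step n d) C D].
Proof.
have [s0 bs0 mD] := build_up_to_maximal C.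
have cD := build_up_convex hC bs0; have sCD := build_up_sub bs0.
have unique s : build_up C s -> maximal_position (last C s) ->
    last C s = last C s0.
  move=> bs ms; have cs := build_up_convex hC bs.
  (* Both end positions are convex and maximal, hence closed, so each build-up stays inside the end
     of the other. *)
  apply/eqP; rewrite eqEsubset; apply/andP; split.
    apply: build_up_in_closed bs _ _ => // v /each_direction_card.
    exact: convex_maximal_closed.
  apply: build_up_in_closed bs0 _ _ => //; first exact: build_up_sub.
  by move=> v /each_direction_card; apply: convex_maximal_closed.
exists (last C s0); split=> //.
- move=> s bs; have [t bt mt] := build_up_to_maximal (last C s).
  have bst : build_up C (s ++ t) by rewrite /build_up cat_path; apply/andP.
  by exists t; split=> //; apply: unique; rewrite ?last_cat.
- apply: final_active_set_extensive => //.
  + by move=> A; apply: subsetUl.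
  + move=> A sAD; rewrite subUset sAD; apply/subsetP => v.
    rewrite inE => /andP[_ le_d]; apply: convex_maximal_closed => //.
    exact: leq_trans le_d (subset_leq_card (black_neighboursS _ sAD)).
  (* A fixed point [E] is closed: a white [v] passing the test would be added by the step. *)
  + move=> E fE sCE; apply: build_up_in_closed bs0 sCE _ => // v.
    move=> /each_direction_card le_d; apply: contraT => vE.
    by move: (vE); rewrite -fE !inE vE le_d orbT.
- apply: final_active_set_extensive => //.
  + by move=> A; apply: subsetUl.
  + move=> A sAD; rewrite subUset sAD; apply/subsetP => v.
    rewrite inE => /andP[_ /(each_directionS sAD)/each_direction_card].
    exact: convex_maximal_closed.
  + move=> E fE sCE; apply: build_up_in_closed bs0 sCE _ => // v hv.
    apply: contraT => vE.
    by move: (vE); rewrite -fE !inE vE [X in _ || X]hv orbT.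
Qed.
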